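(* Let $g:\mathbb{N}\to[1,\infty)$ be a function such that the sequence $([g(n)])_{n=1}^\infty$ is an averaging sequence of recurrence and is pointwise good. Let $S_1,\dots,S_k\subseteq\mathbb{N}$ satisfy $\overline{d}(S_i)>0$ for each $i=1,\dots,k$, and put $D_g=\bigcap_{i=1}^k\Delta_{2,g}(S_i)$. Then there is $S\subseteq\mathbb{N}$ with $d(S)>0$ and $\Delta_{1,g}(S)\subseteq D_g$; furthermore, $\overline{d}(\Delta_{1,g}(S))\ge d(S)>0$. If, in addition, the sequence $([g(n)])_{n=1}^\infty$ is a uniform averaging sequence of recurrence, then the set $D_g$ is syndetic.
   Context: $\mathbb{N}=\{1,2,3,\dots\}$; $[\cdot]$ is the integral part. For $S\subseteq\mathbb{N}$, $\overline{d}(S)=\limsup_{N\to\infty}|S\cap\{1,\dots,N\}|/N$; $d(S)$ denotes $\lim_{N\to\infty}|S\cap\{1,\dots,N\}|/N$ when this limit exists, and an assertion about $d(S)$ includes that it exists. For $m\in\mathbb{N}$, $S-m=\{j\in\mathbb{N}:j+m\in S\}$. For $S\subseteq\mathbb{N}$, $\Delta_{1,g}(S)=\{n\in\mathbb{N}:S\cap(S-[g(n)])\ne\emptyset\}$ and $\Delta_{2,g}(S)=\{n\in\mathbb{N}:\overline{d}(S\cap(S-[g(n)]))>0\}$. A set $C\subseteq\mathbb{N}$ is syndetic if there exist $m_1,\dots,m_\ell\in\mathbb{N}$ with $\bigcup_{i=1}^\ell(C-m_i)=\mathbb{N}$. A measure-preserving system is $(X,\mathcal{B},\mu,T)$ with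 $(X,\mathcal{B},\mu)$ a probability space and $T:X\to X$ a measurable map with $\mu(T^{-1}A)=\mu(A)$ for all $A\in\mathcal{B}$; it is invertible if $T$ is invertible. Let $(a_n)_{n=1}^\infty$ be a sequence in $\mathbb{N}$. It is pointwise good if for every measure-preserving system $(X,\mathcal{B},\mu,T)$ and every $f\in L^2(\mu)$ the limit $\lim_{N\to\infty}\frac1N\sum_{n=1}^Nf(T^{a_n}x)$ exists for almost every $x\in X$. It is an averaging sequence of recurrence if for every invertible measure-preserving system $(X,\mathcal{B},\mu,T)$ and every $A\in\mathcal{B}$ with $\mu(A)>0$, $\lim_{N\to\infty}\frac1N\sum_{n=1}^N\mu(A\cap T^{a_n}A)>0$ (in particular the limit exists). It is a uniform averaging sequence of recurrence if for every such system and every such $A$, $\lim_{N-M\to\infty}\frac1{N-M}\sum_{n=M+1}^N\mu(A\cap T^{a_n}A)>0$ (in particular the limit exists). *)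

(* Defs.v *)
From HB Require Import structures.
From mathcomp Require Import all_boot all_order all_algebra.
From mathcomp Require Import all_classical all_reals all_analysis.
Set Implicit Arguments.
Unset Strict Implicit.
Unset Printing Implicit Defensive.
Import Order.TTheory GRing.Theory Num.Theory numFieldNormedType.Exports.
Local Open Scope classical_set_scope.
Local Open Scope ring_scope.

(* Sets of natural numbers are subsets of {1, 2, 3, ...}: a set S : set nat is
   required to satisfy S `<=` posnat, and every set built below excludes 0.
   A sequence (a_n)_{n >= 1} is a function on nat whose value at 0 is unused. *)
Definition posnat : set nat := [set n | (0 < n)%N].

Definition shift_set (S : set nat) (m : nat) : set nat :=
  [set j | (0 < j)%N /\ S (j + m)%N].

Definition syndetic (C : set nat) : Prop :=
  exists (l : nat) (m : 'I_l -> nat),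
    (forall i, (0 < m i)%N) /\ \bigcup_i shift_set C (m i) = posnat.

(* |S `&` {1, ..., N}| / N *)
Definition dens_upto (R : realType) (S : set nat) (N : nat) : R :=
  (count (fun j => `[< S j >]) (iota 1 N))%:R / N%:R.

(* The sequence dens_upto R S is bounded, so the real-valued limsup is the
   usual one. *)
Definition upper_density (R : realType) (S : set nat) : R :=
  limn_sup (dens_upto R S).

(* The density of S exists and equals d. *)
Definition has_density (R : realType) (S : set nat) (d : R) : Prop :=
  dens_upto R S N @[N --> \oo] --> d.

(* For x >= 0 (here g(n) >= 1), Num.truncn x is the integral part of x. *)
Definition int_part (R : realType) (g : nat -> R) (n : nat) : nat :=
  Num.truncn (g n).

Definition Delta1 (R : realType) (g : nat -> R) (S : set nat) : set nat :=
  [set n | (0 < n)%N /\ S `&` shift_set S (int_part g n) !=set0].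

Definition Delta2 (R : realType) (g : nat -> R) (S : set nat) : set nat :=
  [set n | (0 < n)%N /\ 0 < upper_density R (S `&` shift_set S (int_part g n))].

Definition measure_preserving (R : realType) (d : measure_display)
    (X : measurableType d) (P : probability X R) (T : X -> X) : Prop :=
  measurable_fun [set: X] T /\
  forall A : set X, measurable A -> P (T @^-1` A) = P A.

(* Invertible as a measurable map: the inverse is measurable as well. *)
Definition invertible_system (R : realType) (d : measure_display)
    (X : measurableType d) (P : probability X R) (T : X -> X) : Prop :=
  measure_preserving P T /\
  exists T' : X -> X,
    [/\ cancel T T', cancel T' T & measurable_fun [set: X] T'].

(* (u_{M+1} + ... + u_N) / (N - M) *)
Definition average (R : realType) (u : nat -> R) (M N : nat) : R :=
  (\sum_(M.+1 <= n < N.+1) u n) / (N - M)%:R.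

Definition pointwise_good (R : realType) (a : nat -> nat) : Prop :=
  forall (d : measure_display) (X : measurableType d) (P : probability X R)
    (T : X -> X), measure_preserving P T ->
  forall f : X -> R, f \in Lfun P 2%:E ->
  {ae P, forall x, cvg (average (fun n => f (iter (a n) T x)) 0 N @[N --> \oo])}.

(* n |-> P (A `&` T^(a n) A), with the forward image of A under T^(a n) *)
Definition return_measure (R : realType) (d : measure_display)
    (X : measurableType d) (P : probability X R) (T : X -> X) (A : set X)
    (a : nat -> nat) (n : nat) : R :=
  fine (P (A `&` (iter (a n) T @` A))).

Definition averaging_recurrence (R : realType) (a : nat -> nat) : Prop :=
  forall (d : measure_display) (X : measurableType d) (P : probability X R)
    (T : X -> X), invertible_system P T ->
  forall A : set X, measurable A -> (0 < P A)%E ->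
  exists2 l : R, 0 < l &
    average (return_measure P T A a) 0 N @[N --> \oo] --> l.

(* The limit as N - M --> oo is uniform in the position of the window. *)
Definition uniform_averaging_recurrence (R : realType) (a : nat -> nat) : Prop :=
  forall (d : measure_display) (X : measurableType d) (P : probability X R)
    (T : X -> X), invertible_system P T ->
  forall A : set X, measurable A -> (0 < P A)%E ->
  exists2 l : R, 0 < l &
    forall e : R, 0 < e -> exists K : nat, forall M N : nat, (M + K <= N)%N ->
      `|average (return_measure P T A a) M N - l| < e.

(* Main.v *)
Require Import Defs.
From HB Require Import structures.
From mathcomp Require Import all_boot all_order all_algebra.
From mathcomp Require Import all_classical all_reals all_analysis.
From mathcomp Require Import lra.
Set Implicit Arguments.
Unset Strict Implicit.
Unset Printing Implicit Defensive.
Import Order.TTheory GRing.Theory Num.Theory numFieldNormedType.Exports.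
Local Open Scope classical_set_scope.
Local Open Scope ring_scope.

(**
Write a n for the integral part of g n, and call r a null difference of a set
U when U `&` (U - r) has upper density zero.  A set of naturals is free when
none of its differences is a null difference of one of the S i.  If S1 is free
and contains two points at distance a n, then n belongs to Dg; so everything
takes place inside one free set.

There is a free set S1 with positive density.  An ultrafilter limit of
densities gives, for each S i, a shift-invariant finitely additive mean that
charges S i and charges no set of upper density zero.  Removing from S i
finitely many of the null sets S i `&` (S i - r) does not change its mean, and
averaging over translations then intersects a given finite set with a
translate of what remains at the cost of a constant factor.  After k such
steps, long windows contain free sets of a fixed positive proportion
([common_free]).  Let d be the supremum of such proportions.  A free set that
nearly realises d on a long window has a starting point from which all initial
segments are at least nearly as dense, whereas no free set can exceed d by
much on any long window.  A limit of the sets seen from these starting points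
is free and has density exactly d ([exists_free_density]).

The Furstenberg correspondence turns S1 into an invertible system with a set A
of positive measure such that S1 `&` (S1 - r) has positive upper density
whenever A `&` T^r A has positive measure ([furstenberg_correspondence]).  Let
E be the set of n for which S1 `&` (S1 - a n) has positive upper density.  The
measure of A `&` T^(a n) A is at most the indicator of E, so averaging
recurrence bounds the density of E from below by the positive limit l, and
uniform averaging recurrence makes E meet every window of some fixed length.
Since E is contained in Dg, the latter gives syndeticity.

For the first claim S1 is made sparser without losing E.  Keeping one point of
S1 out of q divides the density by q, which brings it below l.  For n in E the
set S1 `&` (S1 - a n) is unbounded, so a witness pair z, z + a n can be put
back with z at least n ^ 2; all these pairs together have density zero
([small_density_subset]).
*)

(** * Counting in windows and upper density *)

(** Windows are the half-open intervals ]t, t + n], so that the window at 0 is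
    the {1, ..., n} over which densities are taken. *)
Definition cnt (S : set nat) (t n : nat) : nat :=
  count (fun j => `[< S j >]) (iota t.+1 n).

Definition translate (S : set nat) (s : nat) : set nat := [set j | S (j + s)%N].

Lemma cntD S t m n : cnt S t (m + n) = (cnt S t m + cnt S (t + m) n)%N.
Proof. by rewrite /cnt iotaD count_cat addSn. Qed.

Lemma cnt_le_size S t n : (cnt S t n <= n)%N.
Proof. by rewrite -[leqRHS](size_iota t.+1) count_size. Qed.

Lemma eq_cnt S S' t n : (forall j, (t < j <= t + n)%N -> S j <-> S' j) ->
  cnt S t n = cnt S' t n.
Proof.
move=> SS'; apply: eq_in_count => j; rewrite mem_iota addSn ltnS => /SS' SS'j.
by apply/asboolP/asboolP => /SS'j.
Qed.

Lemma le_cnt S S' t n : S `<=` S' -> (cnt S t n <= cnt S' t n)%N.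
Proof.
by move=> SS'; apply: sub_count => j /asboolP ?; apply/asboolP; apply: SS'.
Qed.

Lemma cnt_translate S s t n : cnt (translate S s) t n = cnt S (s + t) n.
Proof.
rewrite /cnt -addnS iotaDl count_map; apply: eq_count => j /=.
by rewrite /translate/= addnC.
Qed.

Lemma cntU S S' t n : (cnt (S `|` S') t n <= cnt S t n + cnt S' t n)%N.
Proof.
rewrite /cnt -count_predUI; apply: leq_trans (leq_addr _ _).
by apply: sub_count => j /=; rewrite asbool_or.
Qed.

Lemma cntU_disjoint S S' t n : S `&` S' = set0 ->
  cnt (S `|` S') t n = (cnt S t n + cnt S' t n)%N.
Proof.
move=> SS'; rewrite /cnt -count_predUI.
rewrite [X in (_ + X)%N](_ : _ = 0%N) ?addn0; last first.
  rewrite -[RHS](count_pred0 (iota t.+1 n)); apply: eq_count => j /=.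
  apply/negP => /andP[/asboolP Sj /asboolP S'j].
  by have : (S `&` S') j by []; rewrite SS'.
by apply: eq_count => j /=; rewrite asbool_or.
Qed.

Lemma cnt_setT t n : cnt setT t n = n.
Proof.
rewrite /cnt (eq_count (a2 := predT)) ?count_predT ?size_iota// => j.
exact/asboolP.
Qed.

Section windows.
Variable R : realType.
Implicit Types (S : set nat) (c : R).

(** Hop through the window along the short intervals given by the hypothesis;
    only the last hop may overshoot, which costs at most J. *)
Lemma cnt_window_le S (c : R) (J : nat) : 0 <= c ->
  (forall t, exists2 j, (0 < j <= J)%N & (cnt S t j)%:R <= c * j%:R) ->
  forall n t, (cnt S t n)%:R <= c * n%:R + J%:R.
Proof.
move=> c0 hop n; elim/ltn_ind: n => n IH t.
have [nJ|Jn] := leqP n J.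
  apply: (@le_trans _ _ J%:R); last by rewrite lerDr mulr_ge0.
  by rewrite ler_nat (leq_trans (cnt_le_size _ _ _)).
have [j /andP[j0 jJ] cj] := hop t.
have jn : (j <= n)%N by rewrite (leq_trans jJ) // ltnW.
rewrite -(subnKC jn) cntD !natrD mulrDr -addrA lerD// IH//.
by rewrite ltn_subrL j0 (leq_trans j0).
Qed.

Lemma dens_uptoE S N : dens_upto R S N = (cnt S 0 N)%:R / N%:R.
Proof. by []. Qed.

Lemma dens_upto_ge0 S N : 0 <= dens_upto R S N.
Proof. by rewrite divr_ge0. Qed.

Lemma dens_upto_le1 S N : dens_upto R S N <= 1.
Proof.
rewrite dens_uptoE; case: N => [|N]; first by rewrite invr0 mulr0.
by rewrite ler_pdivrMr ?ltr0n// mul1r ler_nat cnt_le_size.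
Qed.

Lemma bounded_dens_upto S : bounded_fun (dens_upto R S).
Proof.
exists 1; split => // M M1 N _ /=.
by rewrite ger0_norm ?dens_upto_ge0// (le_trans (dens_upto_le1 _ _))// ltW.
Qed.

Lemma upper_density_gt S c : c < upper_density R S ->
  forall n, exists2 N, (n <= N)%N & c < dens_upto R S N.
Proof.
move=> cS n; apply: contrapT => noN.
have : upper_density R S <= c; last by rewrite leNgt cS.
rewrite /upper_density limn_supE; last exact: bounded_dens_upto.
apply: (@le_trans _ _ (sups (dens_upto R S) n)).
  apply: ge_inf; last by exists n.
  exact/bounded_fun_has_lbound_sups/bounded_dens_upto.
apply: ge_sup; first by exists (dens_upto R S n); exists n => //=.
move=> _ [N /= nN <-]; rewrite leNgt; apply/negP => cN; apply: noN.
by exists N.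
Qed.

Lemma upper_density_ge S c :
  (forall n, exists2 N, (n <= N)%N & c <= dens_upto R S N) ->
  c <= upper_density R S.
Proof.
move=> cS; rewrite /upper_density limn_supE; last exact: bounded_dens_upto.
apply: lb_le_inf; first by exists (sups (dens_upto R S) 0%N); exists 0%N.
move=> _ [n _ <-]; have [N nN cN] := cS n; apply: (le_trans cN).
apply: ub_le_sup; last by exists N.
have [M [_ /(_ (M + 1))]] := bounded_dens_upto S.
rewrite ltrDl ltr01 => /(_ isT) Mle; exists (M + 1) => _ [k _ <-].
by apply: le_trans (Mle k I); exact: ler_norm.
Qed.

Lemma has_density_upper S c : has_density S c -> upper_density R S = c.
Proof. by move=> Sc; rewrite /upper_density (cvg_limn_inf_sup Sc). Qed.

End windows.

(** * Ultrafilter limits and invariant means *)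

(** A cluster point of an ultrafilter is a limit of it, and the unit interval is
    compact. *)
Lemma ultra_cvg_unit (R : realType) (G : set_system nat) (u : nat -> R) :
  UltraFilter G -> (forall n, 0 <= u n <= 1) -> cvg (u n @[n --> G]).
Proof.
move=> UG u01; have FG : ProperFilter G := ultra_proper.
have [|p [_ clp]] := @segment_compact R 0 1 (u n @[n --> G]) _ _.
  by apply: (@filterE _ G) => n; have := u01 n; rewrite /= in_itv.
apply/cvg_ex; exists p => B Bp.
have [//|GnB] := in_ultra_setVsetC (u @^-1` B) UG.
by have [x [/= nBx Bx]] := clp (~` B) B GnB Bp.
Qed.

Lemma exists_free_ultrafilter :
  exists2 G : set_system nat, UltraFilter G & G --> \oo.
Proof.
have [G [UG ooG]] := @ultraFilterLemma nat \oo _.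
by exists G.
Qed.

Section compactness.
Variables (I : eqType) (W : nat -> set I).

(** Compactness of the power set of I for pointwise convergence: V is the limit
    of the W J along a free ultrafilter. *)
Lemma set_seq_cluster : exists V : set I, forall (s : seq I) (n : nat),
  exists2 J, (n <= J)%N & forall i, i \in s -> V i <-> W J i.
Proof.
have [G UG Goo] := exists_free_ultrafilter.
have FG : ProperFilter G := ultra_proper.
exists [set i | G [set J | W J i]] => s n.
suff /filter_ex[J [nJ sJ]] : G [set J | (n <= J)%N /\
    forall i, i \in s -> G [set J | W J i] <-> W J i] by exists J.
apply: filterI; first by apply: Goo; exists n.
elim: s => [|i s IH]; first exact: filterE.
have iG : G [set J | G [set J | W J i] <-> W J i].
  have [Gi|Gi] := in_ultra_setVsetC [set J | W J i] UG.
    by apply: filterS (Gi) => J /= WJ; split.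
  apply: filterS (Gi) => J /= nWJ; split => // Gi'.
  by have [K []] := @filter_ex _ G _ _ (filterI Gi Gi').
apply: filterS (filterI iG IH) => J [/= iJ IHJ] j.
by rewrite inE => /orP[/eqP->//|]; exact: IHJ.
Qed.

End compactness.

Record invariant_mean (R : realType) := InvariantMean {
  mean :> set nat -> R;
  mean_ge0 : forall U, 0 <= mean U;
  mean_setT : mean setT = 1;
  meanU : forall U V, U `&` V = set0 -> mean (U `|` V) = mean U + mean V;
  mean_translate1 : forall U, mean (translate U 1) = mean U }.

(** Densities of initial segments become additive and shift-invariant in the
    limit along an ultrafilter.  The map h selects the lengths of the segments,
    so that the limit can follow a subsequence that realises an upper density. *)
Section density_mean.
Variables (R : realType) (h : nat -> nat) (G : set_system nat).
Hypotheses (UG : UltraFilter G) (hG : h k @[k --> G] --> \oo).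

Definition density_mean (U : set nat) : R :=
  lim (dens_upto R U (h k) @[k --> G]).

Let FG : ProperFilter G := ultra_proper.

Lemma density_mean_cvg U : dens_upto R U (h k) @[k --> G] --> density_mean U.
Proof.
by apply: ultra_cvg_unit => n; rewrite dens_upto_ge0 dens_upto_le1.
Qed.

Lemma density_mean_near (U : set nat) (P : R -> Prop) :
  (exists n, forall N, (n <= N)%N -> P (dens_upto R U N)) ->
  \forall k \near G, P (dens_upto R U (h k)).
Proof.
move=> [n nP]; have : \forall N \near \oo, P (dens_upto R U N) by exists n.
by move/hG.
Qed.

Lemma density_mean_le (U : set nat) (c : R) :
  (exists n, forall N, (n <= N)%N -> dens_upto R U N <= c) -> density_mean U <= c.
Proof.
move=> /(@density_mean_near U (fun x => x <= c)) Uc.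
by apply: limr_le Uc; apply: cvgP; exact: density_mean_cvg.
Qed.

Lemma density_mean_ge (U : set nat) (c : R) :
  (forall k, c <= dens_upto R U (h k)) -> c <= density_mean U.
Proof.
move=> Uc; apply: limr_ge; last exact: filterE.
by apply: cvgP; exact: density_mean_cvg.
Qed.

Lemma density_mean_setT : density_mean setT = 1.
Proof.
have nT n : (0 < n)%N -> dens_upto R setT n = 1.
  by move=> n0; rewrite dens_uptoE cnt_setT divff// pnatr_eq0 -lt0n.
apply/cvg_lim => //; apply: cvg_near_cst.
by apply: (@density_mean_near setT (fun x => x = 1)); exists 1%N => n /nT.
Qed.

Lemma density_meanU U V : U `&` V = set0 ->
  density_mean (U `|` V) = density_mean U + density_mean V.
Proof.
move=> UV; apply/cvg_lim => //.
rewrite (_ : (fun _ => _) =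
    (fun k => dens_upto R U (h k)) \+ (fun k => dens_upto R V (h k))).
  by apply: cvgD; exact: density_mean_cvg.
by apply/funext => k /=; rewrite !dens_uptoE cntU_disjoint// natrD mulrDl.
Qed.

Lemma density_mean_translate1 U : density_mean (translate U 1) = density_mean U.
Proof.
apply/cvg_lim => //.
have -> : (fun k => dens_upto R (translate U 1) (h k)) =
    (fun k => dens_upto R U (h k)) \+
    (fun k => dens_upto R (translate U 1) (h k) - dens_upto R U (h k)).
  by apply/funext => k /=; rewrite addrC subrK.
rewrite -[X in _ --> X]addr0; apply: cvgD; first exact: density_mean_cvg.
apply: (@cvg_comp _ _ _ h
  (fun N => dens_upto R (translate U 1) N - dens_upto R U N)); first exact: hG.
apply/cvgr0Pnorm_le => e e0; near=> N.
have N0 : (0 < N)%N by near: N; exists 1%N.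
rewrite /= !dens_uptoE -mulrBl normrM normfV normr_nat ler_pdivrMr ?ltr0n//.
(* Both sides count U on ]0, N + 1], split after 1 or after N. *)
have dU : (cnt (translate U 1) 0 N + cnt U 0 1 = cnt U 0 N + cnt U N 1)%N.
  have := cntD U 0 N 1; rewrite (addnC N) cntD !add0n cnt_translate addn0.
  by rewrite addnC.
have -> : (cnt (translate U 1) 0 N)%:R - (cnt U 0 N)%:R =
    (cnt U N 1)%:R - (cnt U 0 1)%:R :> R.
  by apply/eqP; rewrite subr_eq addrAC eq_sym subr_eq -!natrD dU addnC.
apply: (@le_trans _ _ 1).
  have : (cnt U N 1)%:R <= 1 :> R by rewrite (ler_nat R _ 1) cnt_le_size.
  have : (cnt U 0 1)%:R <= 1 :> R by rewrite (ler_nat R _ 1) cnt_le_size.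
  have : 0 <= (cnt U N 1)%:R :> R by [].
  have : 0 <= (cnt U 0 1)%:R :> R by [].
  by move=> *; rewrite ler_norml; apply/andP; split; lra.
rewrite mulrC -ler_pdivrMr// div1r; near: N.
exact: nbhs_infty_ger.
Unshelve. all: by end_near. Qed.

Lemma density_mean_ge0 U : 0 <= density_mean U.
Proof. by apply: density_mean_ge => k; exact: dens_upto_ge0. Qed.

Definition density_invariant_mean : invariant_mean R :=
  InvariantMean density_mean_ge0 density_mean_setT density_meanU
    density_mean_translate1.

End density_mean.

Section means.
Variable R : realType.

Lemma exists_mean (S : set nat) : 0 < upper_density R S ->
  exists2 m : invariant_mean R, 0 < m S &
    forall U, 0 < m U -> 0 < upper_density R U.
Proof.
move=> S0; pose c := upper_density R S / 2.
have c0 : 0 < c by rewrite divr_gt0.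
have /upper_density_gt Sc : c < upper_density R S.
  by rewrite /c ltr_pdivrMr// ltr_pMr// ltr1n.
have [h hP] : {h : nat -> nat & forall k, (k <= h k)%N /\ c < dens_upto R S (h k)}.
  by apply: (@choice _ _ (fun k N => (k <= N)%N /\ c < dens_upto R S N)) => k;
    have [N] := Sc k; exists N.
have [G UG Goo] := exists_free_ultrafilter.
have hG : h k @[k --> G] --> \oo.
  apply: (@cvg_trans _ (h k @[k --> \oo])); first exact: cvg_app.
  by move=> B [n _ nB]; exists n => // k /= nk; apply: nB => /=;
    rewrite (leq_trans nk) // (hP k).1.
exists (density_invariant_mean R UG hG) => [|U].
  apply: (lt_le_trans c0); apply: density_mean_ge => k.
  by rewrite ltW // (hP k).2.
apply: contraPP => /negP; rewrite -leNgt => U0; apply/negP; rewrite -leNgt.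
apply/ler_addgt0Pr => e e0; rewrite add0r; apply: density_mean_le => //.
apply: contrapT => noU; have : e <= upper_density R U.
  apply: upper_density_ge => n; apply: contrapT => nU; apply: noU.
  exists n => N nN; rewrite leNgt; apply/negP => eN; apply: nU.
  by exists N; rewrite // ltW.
by move=> /(lt_le_trans e0)/(le_lt_trans U0); rewrite ltxx.
Qed.

End means.

(** * Sets avoiding null differences *)

Section mean_theory.
Variables (R : realType) (m : invariant_mean R).
Implicit Types U V : set nat.

Lemma mean_set0 : m set0 = 0.
Proof.
have := meanU m (setI0 set0); rewrite setU0 => /eqP.
by rewrite -subr_eq subrr => /eqP.
Qed.

Lemma mean_setID U V : m U = m (U `&` V) + m (U `\` V).
Proof.
by rewrite -meanU ?setUIDK// setDE setIACA setICr setI0.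
Qed.

Lemma le_mean U V : U `<=` V -> m U <= m V.
Proof.
by move=> UV; rewrite (mean_setID V U) setIidr// lerDl mean_ge0.
Qed.

Lemma mean_translate U s : m (translate U s) = m U.
Proof.
elim: s => [|s IH].
  by congr (m _); apply/seteqP; split => j; rewrite /translate/= addn0.
rewrite -IH -(mean_translate1 m (translate U s)); congr (m _).
by apply/seteqP; split => j; rewrite /translate/= -addnA add1n.
Qed.

Lemma mean_diff_null U V : m V = 0 -> m (U `\` V) = m U.
Proof.
move=> V0; rewrite (mean_setID U V); suff -> : m (U `&` V) = 0 by rewrite add0r.
apply/le_anti; rewrite mean_ge0 andbT -V0; apply: le_mean; exact: subIsetr.
Qed.

Lemma mean_diff_bigcup_null (U : set nat) (V : nat -> set nat) (L : nat) :
  (forall r, m (V r) = 0) ->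
  m (U `\` [set j | exists2 r, (r < L)%N & V r j]) = m U.
Proof.
move=> V0; elim: L => [|L IH].
  congr (m _); apply/seteqP; split => [j []//|j Uj]; split => // -[r].
  by rewrite ltn0.
rewrite -IH -[RHS](@mean_diff_null _ (V L))//; congr (m _).
apply/seteqP; split => j.
  move=> [Uj nj]; split; last by move=> Vj; apply: nj; exists L.
  by split=> // -[r rL Vj]; apply: nj => /=; exists r => //; exact: ltnW.
move=> [[Uj nj] nL]; split => // -[r].
rewrite ltnS leq_eqVlt => /orP[/eqP->//|rL Vj].
by apply: nj => /=; exists r.
Qed.

(** This is the bound by M * m B of the integral over B of the sum of the
    indicators of the A i.  By induction on s: inside the first A i the other
    sets can cover a point only M - 1 times. *)
Lemma sum_mean_le (I : Type) (s : seq I) (A : I -> set nat) (M : R) (B : set nat) :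
  (forall n, B n -> (count (fun i => `[< A i n >]) s)%:R <= M) ->
  \sum_(i <- s) m (A i `&` B) <= M * m B.
Proof.
elim: s M B => [|i s IH] M B AM.
  rewrite big_nil; have [->|/set0P[n Bn]] := eqVneq B set0.
    by rewrite mean_set0 mulr0.
  by rewrite mulr_ge0 ?mean_ge0// (AM n Bn).
rewrite big_cons (mean_setID B (A i)) mulrDr.
have -> : \sum_(j <- s) m (A j `&` B) =
  \sum_(j <- s) m (A j `&` (B `&` A i)) + \sum_(j <- s) m (A j `&` (B `\` A i)).
  rewrite -big_split; apply: eq_bigr => j _.
  by rewrite (mean_setID _ (A i)) setIA setIDA.
rewrite addrA lerD//; last first.
  by apply: IH => n [Bn Ain]; have := AM n Bn; rewrite /= asboolF.
rewrite setIC -lerBrDl -{2}[m (_ `&` _)]mul1r -mulrBl; apply: IH => n [Bn Ain].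
by have := AM n Bn; rewrite /= asboolT// natrD lerBrDl.
Qed.

(** By [sum_mean_le], with M the largest multiplicity that occurs. *)
Lemma mean_pigeonhole (I : Type) (s : seq I) (A : I -> set nat) :
  exists n, \sum_(i <- s) m (A i) <= (count (fun i => `[< A i n >]) s)%:R.
Proof.
pose P v := `[< exists n, count (fun i => `[< A i n >]) s = v >].
have exP : exists v, P v.
  exists (count (fun i => `[< A i 0%N >]) s).
  by apply/asboolP; exists 0%N.
have Ple v : P v -> (v <= size s)%N by move=> /asboolP[n <-]; exact: count_size.
have [v /asboolP[n nv] vmax] := ex_maxnP exP Ple.
exists n; have := @sum_mean_le I s A v%:R setT; rewrite mean_setT mulr1 nv.
under eq_bigr do rewrite setIT; apply => n' _; rewrite ler_nat; apply: vmax.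
by apply/asboolP; exists n'.
Qed.

End mean_theory.

Definition free (F W : set nat) : Prop := forall x r, W x -> W (x + r)%N -> ~ F r.

Lemma sub_free (F W W' : set nat) : W' `<=` W -> free F W -> free F W'.
Proof. by move=> W'W FW x r /W'W Wx /W'W; exact: FW. Qed.

Lemma free_translate (F W : set nat) s : free F W -> free F (translate W s).
Proof. by move=> FW x r Wx; rewrite /translate/= addnAC; exact: FW. Qed.

Definition null_differences (R : realType) (S : set nat) : set nat :=
  [set r | ~ 0 < upper_density R (S `&` translate S r)].

Section common_free.
Variable R : realType.

(** Only differences below L occur inside the window ]0, L], so it suffices to
    delete from S the finitely many null sets S `&` (S - r) with r < L.  The rest
    has the mean of S, hence a translate of it meets W `&` ]0, L] in at least the
    proportion m S, by the pigeonhole principle applied to its translates by the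
    points of W. *)
Lemma free_refine (S : set nat) : 0 < upper_density R S ->
  exists2 c : R, 0 < c & forall (W : set nat) (L : nat), exists2 W' : set nat,
    W' `<=` W & free (null_differences R S) W' /\
      c * (cnt W 0 L)%:R <= (cnt W' 0 L)%:R.
Proof.
move=> /exists_mean[m mS mP]; exists (m S) => // W L.
pose V r := if `[< null_differences R S r >] then S `&` translate S r else set0.
have V0 r : m (V r) = 0.
  rewrite /V; case: asboolP => [Fr|_]; last exact: mean_set0.
  by apply/le_anti; rewrite mean_ge0 leNgt andbT; apply/negP => /mP.
pose SL := S `\` [set j | exists2 r, (r < L)%N & V r j].
have [n nSL] := mean_pigeonhole m
  [seq w <- iota 1 L | `[< W w >]] (fun w => translate SL w).
exists [set w | [/\ W w, (0 < w <= L)%N & SL (n + w)%N]] => [w []//|]; split.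
  move=> x r /= [Wx /andP[x0 xL] Sx] [_ /andP[_ xrL] Sxr] Fr.
  case: Sx => Sx; apply; exists r.
    by rewrite (leq_trans _ xrL)// -{1}[r]add0n ltn_add2r.
  rewrite /V asboolT//; split => //; case: Sxr => + _.
  by rewrite addnA.
suff <- : \sum_(i <- [seq w <- iota 1 L | `[< W w >]]) m (translate SL i) =
    m S * (cnt W 0 L)%:R.
  apply: (le_trans nSL); rewrite ler_nat count_filter; apply/eq_leq/eq_in_count.
  move=> j; rewrite mem_iota add1n ltnS => j1L /=.
  by rewrite -asbool_and; apply: asbool_equiv_eq; split=> [[]|[]].
under eq_bigr do rewrite mean_translate mean_diff_bigcup_null//.
by rewrite big_const_seq iter_addr_0 count_predT size_filter mulr_natr.
Qed.

Lemma common_free (k : nat) (S : 'I_k -> set nat) :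
  (forall i, 0 < upper_density R (S i)) ->
  exists2 c : R, 0 < c & forall L, exists2 W : set nat,
    forall i, free (null_differences R (S i)) W & c * L%:R <= (cnt W 0 L)%:R.
Proof.
move=> S0; suff [c c0 cP] : exists2 c : R, 0 < c & forall L,
    exists2 W : set nat, forall i, i \in enum 'I_k ->
      free (null_differences R (S i)) W & c * L%:R <= (cnt W 0 L)%:R.
  exists c => // L; have [W WF cW] := cP L; exists W => // i; apply: WF.
  by rewrite mem_enum.
elim: (enum 'I_k) => [|i s [c c0 cP]].
  by exists 1 => // L; exists setT => //; rewrite cnt_setT mul1r.
have [c' c'0 c'P] := free_refine (S0 i).
exists (c' * c) => [|L]; first exact: mulr_gt0.
have [W WF cW] := cP L; have [W' W'W [FW' cW']] := c'P W L.
exists W' => [j|]; last by rewrite -mulrA (le_trans _ cW')// ler_wpM2l// ltW.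
by rewrite inE => /orP[/eqP->//|/WF]; exact: sub_free.
Qed.

End common_free.

(** * A free set of exact positive density *)

Section free_density.
Variables (R : realType) (F : set nat).

(** The proportion x of every initial window can be filled by a free set, which
    may depend on the window. *)
Definition attainable (x : R) : Prop := forall L,
  exists2 W, free F W & x * L%:R <= (cnt W 0 L)%:R.

(** If every translate of a free set W had a short initial segment of density
    below x, hopping along these segments would keep W at density about x in all
    long windows, against the attainability of y > x. *)
Lemma attainable_leader (x y : R) : 0 <= x -> x < y -> attainable y ->
  forall J : nat, exists2 W, free F W &
    forall j, (j <= J)%N -> x * j%:R <= (cnt W 0 j)%:R.
Proof.
move=> x0 xy yF J; apply: contrapT => noW.
have W_le W L : free F W -> (cnt W 0 L)%:R <= x * L%:R + J%:R.
  move=> FW; apply: cnt_window_le => // t.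
  apply: contrapT => noj; apply: noW; exists (translate W t).
    exact: free_translate.
  move=> [|j] jJ; first by rewrite mulr0.
  rewrite cnt_translate addn0 leNgt; apply/negP => jx; apply: noj.
  by exists j.+1 => //; exact: ltW.
pose L := (Num.truncn (J%:R / (y - x))).+1.
have [W FW yW] := yF L; have := le_trans yW (W_le W L FW).
rewrite -lerBlDl -mulrBl leNgt mulrC -ltr_pdivrMr ?subr_gt0//.
by rewrite truncnS_gt.
Qed.

(** The density is the supremum d of attainable proportions.  Leaders of density
    close to d converge to a free set V all of whose initial segments have
    density at least d; as d + e is not attainable, translates of V are bounded
    by d + e on windows of one fixed length, hence on all long ones. *)
Lemma exists_free_density (c : R) : 0 < c -> attainable c ->
  exists (S : set nat) (d : R),
    [/\ S `<=` posnat, free F S, has_density S d & 0 < d].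
Proof.
move=> c0 Ac; pose d := sup attainable.
have A_ub : has_ubound attainable.
  exists 1 => x /(_ 1%N)[W _]; rewrite mulr1 => /le_trans; apply.
  by rewrite (ler_nat R _ 1) cnt_le_size.
have cd : c <= d by exact: ub_le_sup.
have d0 : 0 < d by exact: lt_le_trans cd.
have Wex J : exists W, free F W /\
    forall j, (j <= J)%N -> (d - d / J.+1%:R) * j%:R <= (cnt W 0 j)%:R.
  have dJ : 0 < d / J.+1%:R by rewrite divr_gt0.
  have [|y Ay dy] := @sup_adherent _ attainable (d / J.+1%:R) dJ.
    by split => //; exists c.
  have [|W FW WP] := attainable_leader _ dy Ay J; last by exists W.
  by rewrite subr_ge0 ler_pdivrMr// ler_pMr// ler1n.
have [W WP] := choice Wex; have [V VP] := set_seq_cluster W.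
have FV : free F V.
  move=> x r Vx Vxr; have [J _ VJ] := VP [:: x; (x + r)%N] 0%N.
  by apply: ((WP J).1 x r); apply/VJ; rewrite ?inE ?eqxx ?orbT.
have V_ge j : d * j%:R <= (cnt V 0 j)%:R.
  apply/ler_addgt0Pr => e e0.
  have [J nJ VJ] := VP (iota 1 j) (maxn j (Num.truncn (d * j%:R / e))).
  have -> : cnt V 0 j = cnt (W J) 0 j.
    by apply: eq_cnt => i ij; apply: VJ; rewrite mem_iota add1n ltnS.
  move: nJ; rewrite geq_max => /andP[jJ eJ].
  rewrite -lerBlDr (le_trans _ ((WP J).2 j jJ))// mulrBl lerD2l lerN2.
  rewrite mulrAC ler_pdivrMr// [leRHS]mulrC -ler_pdivrMr// ltW//.
  by rewrite (lt_le_trans (truncnS_gt _))// ler_nat.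
have V_le (e : R) : 0 < e ->
    exists L, forall n, (cnt V 0 n)%:R <= (d + e) * n%:R + L%:R.
  move=> e0; have : ~ attainable (d + e).
    move=> /(ub_le_sup A_ub); rewrite -/d -[X in _ <= X]addr0 lerD2l.
    by rewrite leNgt e0.
  move=> /existsNP[L noW].
  have WL U : free F U -> (cnt U 0 L)%:R < (d + e) * L%:R.
    by move=> FU; rewrite ltNge; apply/negP => UL; apply: noW; exists U.
  exists L => n; apply: cnt_window_le => [|t]; first by rewrite addr_ge0 ?ltW.
  have tL := WL _ (@free_translate F V t FV).
  exists L; last by move: tL; rewrite cnt_translate addn0 => /ltW.
  rewrite leqnn andbT lt0n; apply/eqP => L0.
  by move: tL; rewrite L0 mulr0 ltxx.
exists (V `&` posnat), d; split => //; first by apply: sub_free FV => j [].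
have VE N : dens_upto R (V `&` posnat) N = (cnt V 0 N)%:R / N%:R.
  rewrite dens_uptoE; congr (_%:R / _); apply: eq_cnt => j /andP[j0 _].
  by split=> [[]|].
apply/cvgrPdist_le => e e0; have [L VL] := V_le (e / 2) (divr_gt0 e0 (ltr0Sn _ 1)).
near=> N; rewrite VE.
have N0 : 0 < N%:R :> R by rewrite ltr0n; near: N; exists 1%N.
rewrite distrC ger0_norm ?subr_ge0 ?ler_pdivlMr// lerBlDl ler_pdivrMr//.
apply: (le_trans (VL N)); rewrite !mulrDl -addrA lerD2l.
have LN : L%:R <= e / 2 * N%:R.
  rewrite mulrC -ler_pdivrMr ?divr_gt0//; near: N; exact: nbhs_infty_ger.
by rewrite [in leRHS](splitr e) mulrDl lerD2l.
Unshelve. all: by end_near. Qed.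

End free_density.

(** * The Furstenberg correspondence *)

Definition bilateral := int -> bool.

HB.instance Definition _ := gen_eqMixin bilateral.
HB.instance Definition _ := gen_choiceMixin bilateral.
HB.instance Definition _ := isPointed.Build bilateral (fun=> false).

(** The sets determined by finitely many coordinates; one implication suffices
    since agreement on s is symmetric. *)
Definition cylinder : set (set bilateral) :=
  [set C | exists s : seq int, forall x y : bilateral,
    {in s, x =1 y} -> C x -> C y].

Lemma cylinder0 : cylinder set0.
Proof. by exists [::]. Qed.

Lemma cylinderU : setU_closed cylinder.
Proof.
move=> B C [s sB] [t tC]; exists (s ++ t) => x y xy [Bx|Cx].
  by left; apply: sB Bx => z zs; apply: xy; rewrite mem_cat zs.
by right; apply: tC Cx => z zt; apply: xy; rewrite mem_cat zt orbT.
Qed.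

Lemma cylinderC : setC_closed cylinder.
Proof.
move=> C [s sC]; exists s => x y xy nCx Cy; apply: nCx; apply: sC Cy => z zs.
by rewrite xy.
Qed.

Definition cylinder_display : measure_display. Proof. exact. Qed.

HB.instance Definition _ := @isAlgebraOfSets.Build cylinder_display bilateral
  cylinder cylinder0 cylinderU cylinderC.

(** Points of C outside the first N sets, for all N, would accumulate at a point
    of C outside all the F n, because membership in a cylinder only depends on
    finitely many coordinates. *)
Lemma cylinder_compact (C : set bilateral) (F : nat -> set bilateral) :
  cylinder C -> (forall n, cylinder (F n)) -> C `<=` \bigcup_n F n ->
  exists N, C `<=` \big[setU/set0]_(i < N) F i.
Proof.
move=> [s sC] cF CF; apply: contrapT => noN.
have Wex N : exists W : set int, C (fun z => `[< W z >]) /\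
    forall k, (k < N)%N -> ~ F k (fun z => `[< W z >]).
  apply: contrapT => noW; apply: noN; exists N => x Cx.
  apply: contrapT => nFx; apply: noW; exists [set z | x z].
  have -> : (fun z => `[< [set z | x z] z >]) = x.
    by apply/funext => z /=; rewrite asboolb.
  split=> // k kN Fkx; apply: nFx; rewrite -bigcup_mkord.
  by exists k.
have [W WP] := choice Wex; have [V VP] := set_seq_cluster W.
have [J _ VJ] := VP s 0%N.
have CV : C (fun z => `[< V z >]).
  apply: sC (WP J).1 => z zs; apply: asbool_equiv_eq.
  by have := VJ z zs; tauto.
have [k _ FkV] := CF _ CV; have [t tF] := cF k.
have [K kK VK] := VP t k.+1; apply: ((WP K).2 k kK); apply: tF FkV => z zt.
exact: asbool_equiv_eq (VK z zt).
Qed.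

(** Entries move to the right, so that the r-th image of the set of sequences
    with entry 1 at 0 consists of those with entry 1 at r. *)
Definition bishift (x : bilateral) : bilateral := fun z => x (z - 1).
Definition biunshift (x : bilateral) : bilateral := fun z => x (z + 1).

Lemma bishiftK : cancel bishift biunshift.
Proof. by move=> x; apply/funext => z; rewrite /bishift/biunshift addrK. Qed.

Lemma biunshiftK : cancel biunshift bishift.
Proof. by move=> x; apply/funext => z; rewrite /bishift/biunshift subrK. Qed.

Lemma iter_bishift n x z : iter n bishift x z = x (z - n%:Z).
Proof.
elim: n z => [|n IH] z /=; first by rewrite subr0.
by rewrite {1}/bishift IH -addrA -opprD -intS.
Qed.

Lemma cylinder_bishift C : cylinder C -> cylinder (bishift @^-1` C).
Proof.
move=> [s sC]; exists [seq z - 1 | z <- s] => x y xy; apply: sC => z zs.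
by apply: xy; apply: map_f.
Qed.

Lemma cylinder_biunshift C : cylinder C -> cylinder (biunshift @^-1` C).
Proof.
move=> [s sC]; exists [seq z + 1 | z <- s] => x y xy; apply: sC => z zs.
by apply: xy; apply: map_f.
Qed.

(** The indicator sequence of S, extended by 0 to negative indices and seen from
    position n. *)
Definition orbit_point (S : set nat) (n : nat) : bilateral :=
  fun z => if z + n%:Z is Posz j then `[< S j >] else false.

Lemma bishift_orbit S n : bishift (orbit_point S n.+1) = orbit_point S n.
Proof.
apply/funext => z; rewrite /bishift /orbit_point.
by rewrite (_ : z - 1 + n.+1%:Z = z + n%:Z)// intS addrA subrK.
Qed.

Notation bimeasurable := (g_sigma_algebraType cylinder).

Lemma measurable_bishift :
  measurable_fun [set: bimeasurable] (bishift : bimeasurable -> bimeasurable).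
Proof.
apply: (@measurability _ _ bimeasurable bimeasurable _ _ cylinder) => //.
move=> _ [C cC <-]; apply: sub_sigma_algebra; rewrite setTI.
exact: cylinder_bishift.
Qed.

Lemma measurable_biunshift :
  measurable_fun [set: bimeasurable] (biunshift : bimeasurable -> bimeasurable).
Proof.
apply: (@measurability _ _ bimeasurable bimeasurable _ _ cylinder) => //.
move=> _ [C cC <-]; apply: sub_sigma_algebra; rewrite setTI.
exact: cylinder_biunshift.
Qed.

Section correspondence.
Variables (R : realType) (m : invariant_mean R) (S : set nat).

(** The mean of the set of times at which the orbit of S visits C.  On cylinders
    this is a premeasure: finite additivity comes from the mean and countable
    subadditivity from compactness. *)
Definition visit_mean (C : set bilateral) : \bar R :=
  (m [set n | C (orbit_point S n)])%:E.

Lemma visit_mean_ge0 C : (0 <= visit_mean C)%E.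
Proof. by rewrite lee_fin mean_ge0. Qed.

Lemma visit_mean_bigsetU (F : nat -> set bilateral) n : trivIset setT F ->
  (visit_mean (\big[setU/set0]_(i < n) F i) = \sum_(i < n) visit_mean (F i))%E.
Proof.
move=> tF; elim: n => [|n IH].
  by rewrite !big_ord0 /visit_mean (_ : [set _ | _] = set0)// mean_set0.
rewrite !big_ord_recr/= -IH /visit_mean -EFinD -(meanU m)//.
apply/seteqP; split => // k [/=]; rewrite -bigcup_mkord => -[i /= iN Fi Fn].
have : (F i `&` F n) (orbit_point S k) by [].
by move=> /(fun H => tF i n I I (ex_intro _ _ H)) ni; rewrite ni ltnn in iN.
Qed.

Lemma visit_mean_semi_additive : measure_function.semi_additive visit_mean.
Proof. by move=> F n _ tF _; exact: visit_mean_bigsetU. Qed.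

HB.instance Definition _ := isContent.Build _ _ R visit_mean
  visit_mean_ge0 visit_mean_semi_additive.

Lemma visit_mean_sigma_subadditive : measurable_subset_sigma_subadditive visit_mean.
Proof.
move=> C F mF mC /(cylinder_compact mC mF)[N CN].
apply: (@le_trans _ _ (\sum_(0 <= i < N) visit_mean (F i))%E); last first.
  by apply: nneseries_lim_ge => i _ _; exact: visit_mean_ge0.
by rewrite big_mkord; apply: (content_subadditive visit_mean).
Qed.

HB.instance Definition _ := Content_SigmaSubAdditive_isMeasure.Build _ _ _
  visit_mean visit_mean_sigma_subadditive.

Definition visit_measure : set bimeasurable -> \bar R :=
  measure_extension visit_mean.

HB.instance Definition _ := Measure.on visit_measure.

Lemma visit_measureE C : cylinder C -> visit_measure C = visit_mean C.
Proof. exact: (measurable_mu_extE visit_mean). Qed.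

Lemma visit_measure_setT : visit_measure setT = 1%E.
Proof.
rewrite visit_measureE; last by exists [::].
by rewrite /visit_mean (_ : [set _ | _] = setT)// mean_setT.
Qed.

HB.instance Definition _ :=
  Measure_isProbability.Build _ _ _ visit_measure visit_measure_setT.

Lemma visit_mean_bishift C : visit_mean (bishift @^-1` C) = visit_mean C.
Proof.
rewrite /visit_mean -(mean_translate1 m); congr (m _)%:E.
apply/seteqP; split => n; rewrite /translate/= addn1; by rewrite bishift_orbit.
Qed.

Lemma visit_measure_bishift (A : set bimeasurable) : measurable A ->
  visit_measure (bishift @^-1` A) = visit_measure A.
Proof.
move=> mA; apply/esym.
have finT : sigma_finite [set: bilateral] visit_mean.
  exists (fun=> setT) => [|n]; first by rewrite bigcup_const.
  split; first exact: measurableT.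
  by rewrite /visit_mean ltry.
apply: (measure_extension_unique finT
  (mu' := pushforward visit_measure (bishift : bimeasurable -> bimeasurable))) mA.
  exact: measurable_bishift.
move=> mf C cC; rewrite /= /pushforward.
rewrite visit_measureE ?visit_mean_bishift//.
exact: cylinder_bishift.
Qed.

End correspondence.

(** The set A is the cylinder of sequences with entry 1 at 0, and A `&` T^r A
    asks for entries 1 at 0 and r, so its measure is the mean of the set
    S `&` (S - r). *)
Lemma furstenberg_correspondence (R : realType) (S : set nat) :
  0 < upper_density R S ->
  exists (d : measure_display) (X : measurableType d) (P : probability X R)
    (T : X -> X) (A : set X),
    [/\ invertible_system P T, measurable A, (0 < P A)%E &
      forall r, (0 < P (A `&` (iter r T @` A)))%E ->
        0 < upper_density R (S `&` translate S r)].
Proof.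
move=> /exists_mean[m mS mP].
pose A : set bilateral := [set x | x 0].
have cA r : cylinder [set x | x 0 && x r%:Z].
  exists [:: 0; r%:Z] => x y xy /=.
  by rewrite !xy ?inE ?eqxx ?orbT.
have AE : A = [set x | x 0 && x 0%N%:Z].
  by apply/seteqP; split => x /=; rewrite /A/= andbb.
have PE r : visit_measure m S [set x | x 0 && x r%:Z] =
    (m (S `&` translate S r))%:E.
  rewrite visit_measureE//; congr (m _)%:E; apply/seteqP; split => n.
    rewrite /= /orbit_point add0r -PoszD addnC.
    by move=> /andP[/asboolP ? /asboolP].
  rewrite /= /orbit_point add0r -PoszD addnC.
  by move=> -[? ?]; apply/andP; split; apply/asboolP.
have AT r : A `&` (iter r bishift @` A) = [set x | x 0 && x r%:Z].
  apply/seteqP; split => [x [Ax [y Ay yx]]|x /= /andP[x0 xr]].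
    by rewrite /= -{2}yx iter_bishift subrr; apply/andP.
  split => //; exists (fun z => x (z + r%:Z)); first by rewrite /A/= add0r.
  by apply/funext => z; rewrite iter_bishift subrK.
exists _, bimeasurable, (visit_measure m S), bishift, A; split.
- split; first by split; [exact: measurable_bishift|exact: visit_measure_bishift].
  exists biunshift; split; [exact: bishiftK|exact: biunshiftK|].
  exact: measurable_biunshift.
- by apply: sub_sigma_algebra; rewrite AE; exact: cA.
- rewrite [X in (0 < X)%E](_ : _ = (m S)%:E) ?lte_fin//.
  rewrite [LHS](_ : _ = visit_measure m S A)// AE PE setIidl//.
  by move=> n; rewrite /translate/= addn0.
- move=> r; rewrite [X in (0 < X)%E](_ : _ = (m (S `&` translate S r))%:E).
    by rewrite lte_fin; exact: mP.
  by rewrite -PE -AT.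
Qed.

(** * Lowering the density while keeping differences *)

Definition thin (S : set nat) (q : nat) : set nat :=
  [set j | S j /\ (q %| cnt S 0 j)%N].

Lemma cnt_thin S q n : (0 < q)%N -> cnt (thin S q) 0 n = (cnt S 0 n %/ q)%N.
Proof.
move=> q0; elim: n => [|n IH]; first by rewrite /cnt/= div0n.
have cnt1 U : cnt U n 1 = `[< U n.+1 >] by rewrite /cnt/= addn0.
rewrite -addn1 !cntD !add0n IH !cnt1; case: (asboolP (S n.+1)) => Sn.
  rewrite /= addn1 divnS// addnC; congr (nat_of_bool _ + _)%N.
  rewrite -[RHS]asboolb; apply: asbool_equiv_eq.
  have -> : (cnt S 0 n).+1 = cnt S 0 n.+1.
    by rewrite -[n.+1]addn1 cntD add0n cnt1 asboolT// addn1.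
  by split=> [[]|].
by rewrite asboolF ?addn0// => -[].
Qed.

Section densities.
Variable R : realType.

Lemma cvg_invn : (n%:R^-1 : R) @[n --> \oo] --> 0.
Proof.
rewrite -(@cvg_shiftS R^o); exact: cvg_harmonic.
Qed.

(** The counting function of the thinned set is the integral part of that of S
    divided by q, so the two densities differ by a factor q up to 1 / N. *)
Lemma has_density_thin S (d : R) q : (0 < q)%N -> has_density S d ->
  has_density (thin S q) (d / q%:R).
Proof.
move=> q0 Sd.
have lowc : dens_upto R S N / q%:R - N%:R^-1 @[N --> \oo] --> d / q%:R.
  rewrite -[X in _ --> X]subr0; apply: cvgB; last exact: cvg_invn.
  exact: cvgMr_tmp.
have uppc : dens_upto R S N / q%:R @[N --> \oo] --> d / q%:R.
  exact: cvgMr_tmp.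
apply: squeeze_cvgr lowc uppc; near=> N.
have qR0 : 0 < q%:R :> R by rewrite ltr0n.
rewrite !dens_uptoE cnt_thin// mulrAC; apply/andP; split.
  rewrite -[X in _ - X]mul1r -mulrBl ler_wpM2r// lerBlDr ler_pdivrMr//.
  rewrite natr1 -natrM ler_nat ltnW//.
  exact: ltn_ceil.
rewrite ler_wpM2r// ler_pdivlMr// -natrM ler_nat.
exact: leq_trunc_div.
Unshelve. all: by end_near. Qed.

Lemma has_densityU_null S Z (d : R) : has_density S d -> has_density Z (0 : R) ->
  has_density (S `|` Z) d.
Proof.
move=> Sd Z0.
have uppc : dens_upto R S N + dens_upto R Z N @[N --> \oo] --> d.
  by rewrite -[X in _ --> X]addr0; apply: cvgD.
apply: squeeze_cvgr Sd uppc; near=> N.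
rewrite !dens_uptoE -mulrDl -natrD !ler_wpM2r// ler_nat ?cntU//.
by apply: le_cnt => j; left.
Unshelve. all: by end_near. Qed.

(** If N < K ^ 2, only pairs with n < K can meet {1, ..., N}, which leaves at
    most 2 K points.  For q > 0, the choice K = N / q + q is admissible, and it
    makes 2 K / N close to 2 / q. *)
Lemma sparse_pairs_density (a z : nat -> nat) (Z : set nat) :
  (forall j, Z j -> exists n, (n * n <= z n)%N /\ (j = z n \/ j = (z n + a n)%N)) ->
  has_density Z (0 : R).
Proof.
move=> Zz; have cntZ K N : (N < K * K)%N -> (cnt Z 0 N <= 2 * K)%N.
  move=> NK; rewrite /cnt -size_filter.
  rewrite (_ : (2 * K)%N = size ([seq z n | n <- iota 0 K] ++
      [seq (z n + a n)%N | n <- iota 0 K])); last first.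
    by rewrite size_cat !size_map size_iota mul2n addnn.
  apply: uniq_leq_size; first exact/filter_uniq/iota_uniq.
  move=> j; rewrite mem_filter mem_iota add1n ltnS => /andP[/asboolP/Zz[n [nz jz]]].
  move=> /andP[_ jN]; have nK : n \in iota 0 K.
    rewrite mem_iota add0n /= ltnNge; apply/negP => Kn.
    have : (z n <= N)%N.
      by case: jz jN => -> // /(leq_trans _); apply; exact: leq_addr.
    by move=> /(leq_trans nz); rewrite leqNgt (leq_trans NK)// leq_mul.
  rewrite mem_cat; case: jz => ->; rewrite ?map_f//.
  by rewrite (map_f (fun n => z n + a n)%N) ?orbT.
apply/cvgr0Pnorm_le => e e0.
pose q := (Num.truncn (4 / e)).+1.
have q_ge : 2 / q%:R <= e / 2.
  rewrite ler_pdivrMr ?ltr0n// mulrAC ler_pdivlMr// -natrM mulrC.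
  by rewrite -ler_pdivrMr// ltW// truncnS_gt.
near=> N.
have N0 : 0 < N%:R :> R by rewrite ltr0n; near: N; exists 1%N.
rewrite ger0_norm ?dens_upto_ge0// dens_uptoE ler_pdivrMr//.
have NK : (N < (N %/ q + q) * (N %/ q + q))%N.
  apply: (@leq_trans ((N %/ q).+1 * q)); first exact: ltn_ceil.
  by apply: leq_mul; rewrite ?leq_addl// -addn1 leq_add2l.
have : (cnt Z 0 N)%:R <= 2 * (N %/ q)%:R + 2 * q%:R :> R.
  by rewrite -mulrDr -natrD -natrM ler_nat cntZ.
move=> /le_trans; apply; rewrite [in leRHS](splitr e) [in leRHS]mulrDl lerD//.
  apply: le_trans (ler_wpM2r (ltW N0) q_ge).
  rewrite mulrAC ler_pdivlMr ?ltr0n// -mulrA ler_wpM2l// -natrM ler_nat.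
  exact: leq_trunc_div.
rewrite [leRHS]mulrC -ler_pdivrMr ?divr_gt0//; near: N; exact: nbhs_infty_ger.
Unshelve. all: by end_near. Qed.

Lemma upper_density_unbounded U : 0 < upper_density R U ->
  forall n, exists2 j, (n <= j)%N & U j.
Proof.
move=> U0 n; apply: contrapT => noj.
have cntn N : (cnt U 0 N <= n)%N.
  have [Nn|/ltnW nN] := leqP N n; first exact: leq_trans (cnt_le_size _ _ _) Nn.
  rewrite -(subnKC nN) cntD add0n -[leqRHS]addn0 leq_add ?cnt_le_size//.
  rewrite (@eq_cnt U set0) => [|j /andP[nj _]].
    rewrite leqn0 /cnt (eq_count (a2 := pred0)) ?count_pred0// => j.
    exact/asboolP.
  by split=> // Uj; apply: noj; exists j => //; exact: ltnW.
have c0 : 0 < upper_density R U / 2 by rewrite divr_gt0.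
have /upper_density_gt cU : upper_density R U / 2 < upper_density R U.
  by rewrite ltr_pdivrMr// ltr_pMr// ltr1n.
have [N] := cU (Num.truncn (n%:R / (upper_density R U / 2))).+1.
case: N => // N nN; rewrite dens_uptoE ltr_pdivlMr// ltNge => /negP; apply.
rewrite mulrC -ler_pdivrMr//.
apply: (@le_trans _ _ (n%:R / (upper_density R U / 2))).
  by rewrite ler_wpM2r ?ler_nat// invr_ge0 ltW.
by rewrite ltW// (lt_le_trans (truncnS_gt _))// ler_nat.
Qed.

(** Thinning by a large factor lowers the density below e, and the discarded
    recurrent differences are restored by a null set of witness pairs, taken far
    enough out to be sparse. *)
Lemma small_density_subset (S : set nat) (d e : R) (a : nat -> nat) :
  has_density S d -> 0 < d -> 0 < e ->
  exists (S0 : set nat) (d0 : R),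
    [/\ S0 `<=` S, has_density S0 d0, 0 < d0, d0 <= e &
      forall n, 0 < upper_density R (S `&` translate S (a n)) ->
        exists2 x, S0 x & S0 (x + a n)%N].
Proof.
move=> Sd d0 e0; pose U n := S `&` translate S (a n).
have zex n : exists z, 0 < upper_density R (U n) -> (n * n <= z)%N /\ U n z.
  have [Un|Un] := pselect (0 < upper_density R (U n)); last by exists 0%N => /Un.
  by have [z] := upper_density_unbounded Un (n * n); exists z.
have [z zP] := choice zex.
pose Z := [set j | exists2 n, 0 < upper_density R (U n) &
  j = z n \/ j = (z n + a n)%N].
pose q := (Num.truncn (d / e)).+1.
exists (thin S q `|` Z), (d / q%:R); split.
- move=> j [[]//|[n Un]]; have [_ [Sz Sza]] := zP n Un.
  by case=> ->.
- apply: has_densityU_null; first exact: has_density_thin.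
  apply: (@sparse_pairs_density a z) => j [n Un jz]; exists n; split => //.
  exact: (zP n Un).1.
- by rewrite divr_gt0.
- rewrite ler_pdivrMr// mulrC -ler_pdivrMr// ltW//; exact: truncnS_gt.
- by move=> n Un; exists (z n); right; exists n; auto.
Qed.

End densities.

(** * Return times and the theorem *)

Section recurrence_times.
Variable R : realType.

Lemma average_le_cnt (u : nat -> R) (E : set nat) (M N : nat) : (M <= N)%N ->
  (forall n, (M < n)%N -> u n <= (`[< E n >] : nat)%:R) ->
  average u M N <= (cnt E M (N - M))%:R / (N - M)%:R.
Proof.
move=> MN uE; rewrite /average ler_wpM2r// /cnt -sum1_count natr_sum.
rewrite /index_iota subSS [leRHS]big_mkcond big_seq [leRHS]big_seq.
apply: ler_sum => n; rewrite mem_iota => /andP[/uE].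
by case: asboolP.
Qed.

Lemma return_measure_le_indicator (S : set nat) (d : measure_display)
    (X : measurableType d) (P : probability X R) (T : X -> X) (A : set X)
    (a : nat -> nat) :
  invertible_system P T -> measurable A ->
  (forall r, (0 < P (A `&` (iter r T @` A)))%E ->
    0 < upper_density R (S `&` translate S r)) ->
  forall n, return_measure P T A a n <=
    (`[< 0 < upper_density R (S `&` translate S (a n)) >] : nat)%:R.
Proof.
move=> [_ [T' [TK T'K mT']]] mA PS n; rewrite /return_measure.
have mAn : measurable (A `&` (iter (a n) T @` A)).
  apply: measurableI => //.
  have -> : iter (a n) T @` A = iter (a n) T' @^-1` A.
    have itK r : cancel (iter r T) (iter r T').
      by elim: r => // r IH x; rewrite iterSr /= TK IH.
    have it'K r : cancel (iter r T') (iter r T).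
      by elim: r => // r IH x; rewrite iterSr /= T'K IH.
    apply/seteqP; split => [_ [x Ax <-]|x Ax]; first by rewrite /= itK.
    by exists (iter (a n) T' x); last exact: it'K.
  rewrite -[X in measurable X]setTI.
  suff : measurable_fun setT (iter (a n) T') by apply.
  elim: (a n) => [|r IH]; first exact: measurable_id.
  exact: (measurableT_comp mT' IH).
case: asboolP => [_|nS].
  rewrite -lee_fin fineK ?fin_num_measure//; exact: probability_le1.
have -> // : P (A `&` (iter (a n) T @` A)) = 0%E.
by apply/eqP; rewrite eq_le measure_ge0 andbT leNgt; apply/negP => /PS.
Qed.

End recurrence_times.

Theorem theorem3p12 (R : realType) (g : nat -> R) (k : nat)
    (S : 'I_k -> set nat)
    (g_ge1 : forall n : nat, (0 < n)%N -> 1 <= g n)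
    (g_avg : averaging_recurrence R (int_part g))
    (g_good : pointwise_good R (int_part g))
    (k_gt0 : (0 < k)%N)
    (S_pos : forall i : 'I_k, S i `<=` posnat)
    (S_dens : forall i : 'I_k, 0 < upper_density R (S i)) :
  let Dg : set nat := \bigcap_(i in [set: 'I_k]) Delta2 g (S i) in
  (exists (S0 : set nat) (dS0 : R),
     [/\ S0 `<=` posnat,
         has_density S0 dS0,
         0 < dS0,
         Delta1 g S0 `<=` Dg &
         dS0 <= upper_density R (Delta1 g S0)])
  /\ (uniform_averaging_recurrence R (int_part g) -> syndetic Dg).
Proof.
move=> Dg; pose a := int_part g.
pose F := \bigcup_i null_differences R (S i).
have [c c0 cS] := common_free S_dens.
have /(exists_free_density c0)[S1 [d [S1_pos FS1 S1d d0]]] : attainable F c.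
  move=> L; have [W WF cW] := cS L; exists W => // x r Wx Wxr [i _].
  exact: WF Wx Wxr.
(* Differences of S1 of the form a n are null differences of no S i. *)
have S1_Dg x n : (0 < n)%N -> S1 x -> S1 (x + a n)%N -> Dg n.
  move=> n0 Sx Sxn i _; split => //.
  rewrite (_ : _ `&` _ = S i `&` translate (S i) (a n)); last first.
    by apply/seteqP; split => j [Sj]; [case|split=> //; split=> //; exact: S_pos Sj].
  by apply: contrapT => nSi; apply: (FS1 _ _ Sx Sxn); exists i.
have [|disp [X [P [T [A [TP mA PA PS]]]]]] := @furstenberg_correspondence R S1.
  by rewrite (has_density_upper S1d).
pose E := [set n | 0 < upper_density R (S1 `&` translate S1 (a n))].
have avgE M N : (M <= N)%N ->
    average (return_measure P T A a) M N <= (cnt E M (N - M))%:R / (N - M)%:R.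
  move=> MN; apply: average_le_cnt => // n _.
  exact: (return_measure_le_indicator a TP mA PS n).
split.
  have [l l0 lP] := g_avg _ _ _ _ TP _ mA PA.
  have l20 : 0 < l / 2 by rewrite divr_gt0.
  have [S0 [e [S0S1 S0e e0 el S0P]]] := small_density_subset a S1d d0 l20.
  exists S0, e; split => //.
  - by apply: subset_trans S1_pos.
  - by move=> n [n0 [x [/S0S1 Sx [_ /S0S1]]]]; exact: S1_Dg.
  have : \forall N \near \oo, l / 2 < average (return_measure P T A a) 0 N.
    apply: (cvgr_gt l lP).
    by rewrite ltr_pdivrMr// ltr_pMr// ltr1n.
  move=> [N0 _ N0P]; apply: (le_trans el); apply: upper_density_ge => n.
  exists (maxn n N0); first exact: leq_maxl.
  apply: (le_trans (ltW (N0P _ (leq_maxr n _)))).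
  apply: (le_trans (avgE _ _ (leq0n _))).
  rewrite subn0 dens_uptoE ler_wpM2r//.
  rewrite ler_nat (@eq_cnt E (E `&` posnat)) => [|j /andP[j0 _]]; last first.
    by split=> [|[]].
  apply: le_cnt => j [/S0P[x S0x S0xj] j0]; split => //.
  exists x; split => //; split => //; exact/S1_pos/S0S1.
move=> /(_ _ _ _ _ TP _ mA PA)[l l0 /(_ l l0)[K KP]].
exists K.+1, (fun i => i.+1); split => //.
apply/seteqP; split => [j [i _ []//]|j j0].
have jK : (j + K <= j + K.+1)%N by rewrite leq_add2l.
have avg0 : 0 < average (return_measure P T A a) j (j + K.+1).
  by have := KP _ _ jK; rewrite ltr_norml => /andP[+ _]; rewrite ltrBrDr addNr.
have := lt_le_trans avg0 (avgE _ _ (leq_addr _ _)).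
rewrite addKn pmulr_lgt0 ?invr_gt0 ?ltr0n// -has_count => /hasP[n].
rewrite mem_iota addSn ltnS => /andP[jn nK] /asboolP En.
have [x _ [Sx Sxn]] := upper_density_unbounded En 0.
have iK : (n - j.+1 < K.+1)%N by rewrite ltn_subLR// addSnnS.
exists (Ordinal iK) => //; split => //=.
have -> : (j + (n - j.+1).+1 = n)%N by rewrite -addSnnS subnKC.
by apply: (S1_Dg x) => //; apply: leq_trans jn.
Qed.
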